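(* Let $q$ be a prime power, let $f \in \mathbb{F}_q[x]$ be a nonconstant monic polynomial, and let $D_1, D_2$ be subsets of $\mathrm{Div}(f)$ with $f \notin D_1$ and $f \notin D_2$. Suppose that the gcd-graphs $G_f(D_1)$ and $G_f(D_2)$ have the same spectral vector, i.e. $\lambda_g(f,D_1) = \lambda_g(f,D_2)$ for every $g \in \mathbb{F}_q[x]/f$. Then $D_1 = D_2$.
   Context: $\mathrm{Div}(f)$ is the set of monic divisors of $f$. For $D \subset \mathrm{Div}(f)$ with $f \notin D$, the gcd-graph $G_f(D)$ is the simple undirected graph with vertex set $\mathbb{F}_q[x]/f$ in which $a,b$ are adjacent iff $\gcd(a-b,f) \in D$. Ramanujan sums: let $p$ be the characteristic of $\mathbb{F}_q$, $\zeta_p$ a primitive $p$-th root of unity, and $\mathrm{Tr}:\mathbb{F}_q \to \mathbb{F}_p$ the trace map. For a monic polynomial $h$ and $g \in \mathbb{F}_q[x]$, set $c(g,h) = \sum_{a \in (\mathbb{F}_q[x]/h)^{\times}} \zeta_p^{\mathrm{Tr}(\psi(ga))}$, where $\psi: \mathbb{F}_q[x]/h \to \mathbb{F}_q$ is a non-degenerate $\mathbb{F}_q$-linear functional (its kernel contains no nonzero ideal). The value does not depend on the choice of $\psi$; it is known that $c(g,h) = \mu(t)\varphi(h)/\varphi(t)$ with $t = h/\gcd(g,h)$, where $\varphi(h) = |(\mathbb{F}_q[x]/h)^\times|$ and $\mu$ is the Möbius function on monic polynomials ($\mu(t)=(-1)^r$ if $t$ is a product of $r$ distinct monic irreducibles,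 and $\mu(t)=0$ if $t$ is not squarefree). The spectral vector of $G_f(D)$ is $\vec{\lambda}(f,D) = (\lambda_g(f,D))_{g \in \mathbb{F}_q[x]/f}$, where $\lambda_g(f,D) = \sum_{d \in D} c(g, f/d)$. *)

(* Defs.v *)
From HB Require Import structures.
From mathcomp Require Import all_boot all_order all_algebra all_fingroup.
From mathcomp Require Import all_solvable all_field finmap.

Set Implicit Arguments.
Unset Strict Implicit.
Unset Printing Implicit Defensive.

Import GRing.Theory Num.Theory.
Local Open Scope ring_scope.

Definition Div (F : fieldType) (f : {poly F}) : {pred {poly F}} :=
  [pred d | (d \is monic) && (d %| f)].

Section AbsoluteTrace.
Variables (F : finFieldType) (p : nat) (pF : p \in [pchar F]).

Let L := pPrimeCharType pF.

(* The Galois trace of F over 'F_p, transported from the prime subfield of F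
   back to 'F_p.  The [pick] never fails and has at most one candidate, see
   [absTraceP]. *)
Definition absTrace (a : F) : 'F_p :=
  odflt 0 [pick k : 'F_p | k%:A == galTrace 1 {:L} (a : L)].

Lemma absTraceP (a : F) : (absTrace a)%:A = galTrace 1 {:L} (a : L).
Proof.
rewrite /absTrace; case: pickP => [k /eqP //|noK].
have galL : galois 1 {:L} by apply: finField_galois; apply: subvf.
have /vlineP[k Dk] := mem_galTrace galL (memvf (a : L)).
by have := noK k; rewrite Dk eqxx.
Qed.

End AbsoluteTrace.

Section RamanujanSum.
Variable F : finFieldType.

Definition is_ideal (A : comNzRingType) (I : {pred A}) : Prop :=
  [/\ 0 \in I,
      {in I &, forall a b, a + b \in I}
    & forall r a, a \in I -> r * a \in I].

(* The kernel of psi contains no nonzero ideal.  [{poly %/ h}] is F[x]/h only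
   for h monic and nonconstant; by convention it is F[x]/'X for other h. *)
Definition nondegenerate_functional (h : {poly F})
    (psi : {scalar {poly %/ h}}) : Prop :=
  forall I : {pred {poly %/ h}}, is_ideal I ->
    {in I, forall a, psi a = 0} -> {in I, forall a, a = 0}.

(* The coefficient of 'X^(deg h - 1) is a nondegenerate functional. *)
Lemma nondegenerate_functional_exists (h : {poly F}) :
  exists psi : {scalar {poly %/ h}}, nondegenerate_functional psi.
Proof.
set n := (size (mk_monic h)).-2.
pose phi (a : {poly %/ h}) : F := (a : {poly F})`_n.
have phiL : scalar phi.
  by move=> k a b; rewrite /phi poly_of_qpolyD poly_of_qpolyZ coefD coefZ.
pose phiM := GRing.isLinear.Build F {poly %/ h} F *%R phi phiL.
pose psi : {scalar {poly %/ h}} := HB.pack phi phiM.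
have psiE a : psi a = (a : {poly F})`_n by [].
exists psi => I [_ _ IM] kerI a Ia; apply/eqP/negPn/negP => a0.
have hQ := size_mk_monic_gt1 h; have sa := size_mk_monic a.
have sa0 : (0 < size (a : {poly F}))%N by rewrite size_poly_gt0.
pose j := (n.+1 - size (a : {poly F}))%N.
have Dn : size (mk_monic h) = n.+2 by rewrite /n; case: (size _) hQ => [|[]].
have jn : (j + size (a : {poly F}))%N = n.+1 by rewrite subnK // -ltnS -Dn.
have sXa : size ('X^j * (a : {poly F})) = n.+1.
  by rewrite size_monicM ?monicXn // size_polyXn addSn jn.
have Da : in_qpoly h a = a by apply: val_inj; exact: in_qpoly_small.
have := kerI _ (IM (in_qpoly h 'X^j) a Ia).
rewrite -[in X in _ * X]Da -in_qpolyM psiE in_qpoly_small ?sXa ?Dn // => /eqP.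
have -> : n = (size ('X^j * (a : {poly F}))).-1 by rewrite sXa.
rewrite -/(lead_coef _) lead_coef_eq0 mulf_eq0 -!size_poly_eq0 size_polyXn.
by case/orP=> // sz0; case/negP: (lt0n_neq0 sa0).
Qed.

Variables (C : numClosedFieldType) (p : nat) (pF : p \in [pchar F]).

(* c(g, h), computed with a chosen primitive root zeta and functional psi on
   F[x]/h. *)
Definition ramanujan_sum (zeta : C) (h : {poly F}) (psi : {scalar {poly %/ h}})
    (g : {poly F}) : C :=
  \sum_(a : {poly %/ h} | a \is a GRing.unit)
     zeta ^+ absTrace pF (psi (in_qpoly h g * a)).

(* An element g of F[x]/f is represented by its remainder mod f, a polynomial;
   since f / d divides f, its class mod f / d does not depend on this choice.
   When f \notin D, each f / d is nonconstant, so the type {poly %/ (f %/ d)} is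
   the intended quotient. *)
Definition spectral_vector (zeta : C)
    (psi : forall h : {poly F}, {scalar {poly %/ h}})
    (f : {poly F}) (D : {fset {poly F}}) : {ffun {poly %/ f} -> C} :=
  [ffun g : {poly %/ f} =>
     \sum_(d <- D) ramanujan_sum zeta (psi (f %/ d)) (g : {poly F})].

End RamanujanSum.

(* Main.v *)
(* For h | f and a unit a mod h, g |-> zeta^Tr(psi_h(g a)) is an additive
   character of F[x]/f.  By nondegeneracy of psi_h and of the trace, the
   annihilator of this character is (h) and distinct pairs (h, a) give distinct
   characters.  The spectral vector of D is the sum of the characters with f / h
   in D, so D is recovered from it by orthogonality of characters. *)
From HB Require Import structures.
Require Import Defs.
From mathcomp Require Import all_boot all_order all_algebra all_fingroup.
From mathcomp Require Import all_solvable all_field finmap.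

Set Implicit Arguments.
Unset Strict Implicit.
Unset Printing Implicit Defensive.

Import GRing.Theory Num.Theory.
Local Open Scope ring_scope.

(** Translating the index by [v] multiplies the sum by [e v], so the sum times [1 - e v]
    vanishes. *)
Lemma sum_nontrivial_char (V : finZmodType) (R : idomainType) (e : V -> R)
    (v : V) :
  {morph e : x y / x + y >-> x * y} -> e v != 1 -> \sum_x e x = 0.
Proof.
move=> eD ev1; have : \sum_x e x = \sum_x e x * e v.
  by rewrite [LHS](reindex_inj (addIr v)); apply: eq_bigr => x _; apply: eD.
rewrite -mulr_suml => /eqP; rewrite -subr_eq0 -{1}[\sum_x e x]mulr1 -mulrBr.
by rewrite mulf_eq0 subr_eq0 [1 == _]eq_sym (negPf ev1) orbF => /eqP.
Qed.

Section Quotient.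
Variable F : finFieldType.

Lemma in_qpoly_eq0 (h g : {poly F}) :
  h \is monic -> (1 < size h)%N -> (in_qpoly h g == 0) = (h %| g).
Proof.
move=> hM hS; rewrite -val_eqE /= /mk_monic hS hM /=.
by rewrite dvdpE.
Qed.

Lemma in_qpolyK (h : {poly F}) :
  cancel (@polyn _ _ : {poly %/ h} -> _) (in_qpoly h).
Proof.
by move=> g; apply: val_inj; apply: in_qpoly_small; apply: size_mk_monic.
Qed.

(** The multiples of [u] form an ideal inside the kernel of [psi]. *)
Lemma nondegenerate_mul (h : {poly F}) (psi : {scalar {poly %/ h}}) u :
  nondegenerate_functional psi -> (forall r, psi (r * u) = 0) -> u = 0.
Proof.
move=> psiP psi0; pose I := [pred b | [exists r, b == r * u]].
apply: (psiP I) => [|b /existsP[r /eqP->] //|]; last first.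
  by apply/existsP; exists 1; rewrite mul1r.
split=> [|a b /existsP[r /eqP->] /existsP[s /eqP->]|r a /existsP[s /eqP->]].
- by apply/existsP; exists 0; rewrite mul0r.
- by apply/existsP; exists (r + s); rewrite mulrDl.
- by apply/existsP; exists (r * s); rewrite mulrA.
Qed.

Lemma in_qpoly_mod (h f g : {poly F}) :
  f \is monic -> (1 < size f)%N -> h \is monic -> (1 < size h)%N -> h %| f ->
  in_qpoly h (in_qpoly f g) = in_qpoly h g.
Proof.
move=> fM fS hM hS hf; apply/eqP; rewrite -subr_eq0 -raddfB in_qpoly_eq0 //.
apply: (dvdp_trans hf); rewrite -in_qpoly_eq0 // raddfB subr_eq0.
by apply/eqP; apply: (in_qpolyK (in_qpoly f g)).
Qed.

End Quotient.

Section Trace.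
Variables (F : finFieldType) (p : nat) (pF : p \in [pchar F]).

Lemma absTraceB : zmod_morphism (absTrace pF).
Proof.
move=> a b; have inj := fmorph_inj (in_alg (pPrimeCharType pF)).
by apply: inj; rewrite rmorphB /= !absTraceP -raddfB.
Qed.

HB.instance Definition _ :=
  GRing.isZmodMorphism.Build F 'F_p (absTrace pF) absTraceB.

Lemma absTrace_neq0 : exists k, absTrace pF k != 0.
Proof.
pose L := pPrimeCharType pF.
(* Independence of the Galois automorphisms, applied with all coefficients 1: this combination is
   the trace. *)
have [a _ nz] := gal_independent_contra
  (c_ := fun _ : gal_of {: L} => 1 : L) (group1 'Gal({: L} / 1)) (oner_neq0 L).
exists a; apply: contraNneq nz => Tr0.
under eq_bigr do rewrite mul1r.
by have := absTraceP pF a; rewrite Tr0 scale0r => /esym /eqP.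
Qed.

Lemma absTrace_nondegenerate (x : F) :
  (forall k, absTrace pF (k * x) = 0) -> x = 0.
Proof.
move=> Tr0; apply/eqP/negPn/negP => x0; have [k /eqP[]] := absTrace_neq0.
by rewrite -(divfK x0 k) Tr0.
Qed.

Section Zeta.
Variables (C : numClosedFieldType) (zeta : C) (zetaP : p.-primitive_root zeta).

Let p_pr : prime p := pcharf_prime pF.

Lemma prim_rootXD : {morph (fun k : 'F_p => zeta ^+ k) : x y / x + y >-> x * y}.
Proof.
move=> x y /=; rewrite -exprD -[RHS](prim_expr_mod zetaP).
(* Addition in ['F_p] reduces modulo [(Zp_trunc (pdiv p)).+2], which is [p] because [p] is prime. *)
by congr (_ ^+ (_ %% _)); apply: Fp_cast.
Qed.

Lemma prim_rootX_inj : injective (fun k : 'F_p => zeta ^+ k).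
Proof.
have ltxp (x : 'F_p) : (x < p)%N by rewrite -[ltnRHS](Fp_cast p_pr).
move=> x y /eqP; rewrite (eq_prim_root_expr zetaP) !modn_small //.
by move=> /eqP /val_inj.
Qed.

(** The summand of [ramanujan_sum]. It takes a polynomial [g], so that characters attached to
    different moduli [h] have a common domain. *)
Definition qchar (h : {poly F}) (psi : {scalar {poly %/ h}})
    (a : {poly %/ h}) (g : {poly F}) : C :=
  zeta ^+ absTrace pF (psi (in_qpoly h g * a)).

Lemma qcharD h (psi : {scalar {poly %/ h}}) a :
  {morph qchar psi a : x y / x + y >-> x * y}.
Proof.
by move=> x y; rewrite /qchar in_qpolyD mulrDl !raddfD prim_rootXD.
Qed.

Lemma qchar0 h (psi : {scalar {poly %/ h}}) a : qchar psi a 0 = 1.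
Proof. by rewrite /qchar in_qpoly0 mul0r !raddf0. Qed.

Lemma qcharN h (psi : {scalar {poly %/ h}}) a g :
  qchar psi a g * qchar psi a (- g) = 1.
Proof. by rewrite -qcharD subrr qchar0. Qed.

(** Evaluating both characters at [k *: g] for every scalar [k] shows that the difference of the two
    values is orthogonal to all of [F] under the trace form. *)
Lemma eq_qchar (h h' : {poly F}) (psi : {scalar {poly %/ h}})
    (psi' : {scalar {poly %/ h'}}) a a' :
  qchar psi a =1 qchar psi' a' ->
  forall g, psi (in_qpoly h g * a) = psi' (in_qpoly h' g * a').
Proof.
move=> eq_ch g; apply/eqP; rewrite -subr_eq0; apply/eqP.
apply: absTrace_nondegenerate => k; apply/eqP.
have := prim_rootX_inj (eq_ch (k *: g)).
rewrite !in_qpolyZ -!scalerAl !linearZ /= => /eqP.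
by rewrite -subr_eq0 -raddfB -mulrBr.
Qed.

Lemma qchar_inj h (psi : {scalar {poly %/ h}}) a a' :
  nondegenerate_functional psi -> qchar psi a =1 qchar psi a' -> a = a'.
Proof.
move=> psiP /eq_qchar eq_psi; apply/eqP; rewrite -subr_eq0; apply/eqP.
apply: nondegenerate_mul psiP _ => r; apply/eqP.
by rewrite mulrBr linearB subr_eq0 -(in_qpolyK r) /= eq_psi.
Qed.

(** Multiples of [h] are zero mod [h], hence [psi'] vanishes on all [r * h * a']. Nondegeneracy
    gives [h * a' = 0] mod [h'], and the unit [a'] cancels. *)
Lemma eq_qchar_dvdp (h h' : {poly F}) (psi : {scalar {poly %/ h}})
    (psi' : {scalar {poly %/ h'}}) a a' :
    h \is monic -> (1 < size h)%N -> h' \is monic -> (1 < size h')%N ->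
    nondegenerate_functional psi' -> a' \is a GRing.unit ->
  qchar psi a =1 qchar psi' a' -> h' %| h.
Proof.
move=> hM hS h'M h'S psi'P a'U /eq_qchar eq_psi; rewrite -in_qpoly_eq0 //.
rewrite -(mulIr_eq0 _ (mulIr a'U)); apply/eqP.
apply: nondegenerate_mul psi'P _ => r.
rewrite -[r]in_qpolyK mulrA -in_qpolyM -eq_psi in_qpolyM.
have /eqP-> : in_qpoly h h == 0 by rewrite in_qpoly_eq0.
by rewrite mulr0 mul0r raddf0.
Qed.

Lemma sum_qchar_eq (f h : {poly F}) (psi : {scalar {poly %/ h}}) a :
  \sum_(g : {poly %/ f}) qchar psi a g * qchar psi a (- (g : {poly F})) =
    #|{: {poly %/ f}}|%:R.
Proof. by under eq_bigr do rewrite qcharN; rewrite sumr_const. Qed.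

(** Orthogonality: evaluation at [- g] inverts a character, so the summand is the quotient of the
    two. If they differ somewhere, this quotient is a nontrivial character of F[x]/f. *)
Lemma sum_qchar_neq0 (f h h' : {poly F}) (psi : {scalar {poly %/ h}})
    (psi' : {scalar {poly %/ h'}}) a a' :
    f \is monic -> (1 < size f)%N ->
    h \is monic -> (1 < size h)%N -> h %| f ->
    h' \is monic -> (1 < size h')%N -> h' %| f ->
    \sum_(g : {poly %/ f})
      qchar psi a g * qchar psi' a' (- (g : {poly F})) != 0 ->
  qchar psi a =1 qchar psi' a'.
Proof.
move=> fM fS hM hS hf h'M h'S h'f sum_n0 g; apply/eqP.
apply: contraNT sum_n0 => neq_ch; apply/eqP.
apply: (@sum_nontrivial_char {poly %/ f} _ _ (in_qpoly f g)) => [x y|].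
  by rewrite poly_of_qpolyD opprD !qcharD mulrACA.
(* If the quotient is 1 at the class of [g], clearing the inverse gives equality at the remainder of
   [g] mod [f], hence at [g], since [h] and [h'] divide [f]. *)
apply: contraNneq neq_ch => /(congr1 ( *%R^~ (qchar psi' a' (in_qpoly f g)))).
rewrite -mulrA mul1r [X in _ * X]mulrC qcharN mulr1 /qchar.
by rewrite !in_qpoly_mod // => ->.
Qed.

End Zeta.
End Trace.

Lemma divisor_cofactor (F : fieldType) (f d : {poly F}) :
    f \is monic -> d \in Div f -> d != f ->
  [/\ f %/ d \is monic, (1 < size (f %/ d)%R)%N & f %/ d %| f].
Proof.
move=> fM /andP[dM df] nd; have Df := divpK df.
have hM : f %/ d \is monic by rewrite -(monicMr _ dM) Df.
split=> //; last by rewrite -{2}Df dvdp_mulIl.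
(* A constant monic cofactor is 1, which would force [d = f]. *)
rewrite ltnNge; apply: contraNN nd => hs; rewrite -Df.
move: hM; rewrite (size1_polyC hs) monicE lead_coefC => /eqP->.
by rewrite mul1r.
Qed.

Lemma divp_divisor_inj (F : fieldType) (f : {poly F}) :
  f != 0 -> {in Div f &, injective (fun d => f %/ d)}.
Proof.
move=> f0 d d' /andP[_ df] /andP[_ d'f] /= eq_h.
have h0 : f %/ d != 0 by rewrite dvdp_div_eq0.
by apply: (mulfI h0); rewrite {2}eq_h !divpK.
Qed.

(** The Fourier coefficient at the character with modulus [f %/ d] and unit 1. That character occurs
    in the spectral vector, exactly once, if and only if [d] is in [D]. *)
Lemma spectral_vector_coef (F : finFieldType) (p : nat) (pF : p \in [pchar F])
    (C : numClosedFieldType) (zeta : C)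
    (psi : forall h : {poly F}, {scalar {poly %/ h}})
    (f d : {poly F}) (D : {fset {poly F}}) :
    p.-primitive_root zeta ->
    (forall h : {poly F}, h \is monic -> (1 < size h)%N ->
       nondegenerate_functional (psi h)) ->
    f \is monic -> (1 < size f)%N ->
    {subset D <= Div f} -> f \notin D -> d \in Div f -> d != f ->
  \sum_(g : {poly %/ f}) spectral_vector pF zeta psi f D g *
     qchar pF zeta (psi (f %/ d)) 1 (- (g : {poly F})) =
  #|{: {poly %/ f}}|%:R *+ (d \in D).
Proof.
move=> zetaP psiP fM fS DDiv Df dDiv nd.
have [hM hS hf] := divisor_cofactor fM dDiv nd.
under eq_bigr do rewrite ffunE mulr_suml.
rewrite exchange_big /=.
transitivity (\sum_(e <- D) (if e == d then #|{: {poly %/ f}}|%:R : C else 0)).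
  apply: eq_big_seq => e De; have eDiv := DDiv _ De.
  have ne : e != f by apply: contraNneq Df => <-.
  have [kM kS kf] := divisor_cofactor fM eDiv ne.
  under eq_bigr do rewrite mulr_suml; rewrite exchange_big /=.
  have orth a : a \is a GRing.unit ->
      \sum_(g : {poly %/ f}) qchar pF zeta (psi (f %/ e)) a g *
         qchar pF zeta (psi (f %/ d)) 1 (- (g : {poly F})) != 0 -> e = d.
    move=> aU /(sum_qchar_neq0 zetaP fM fS kM kS kf hM hS hf) eq_ch.
    apply: (divp_divisor_inj (monic_neq0 fM)) => //; apply/eqP.
    (* Equal characters have the same annihilator, so the two monic moduli divide each other. *)
    rewrite -eqp_monic // /eqp; apply/andP; split.
      exact: (eq_qchar_dvdp zetaP hM hS kM kS (psiP _ kM kS) aU (fsym eq_ch)).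
    apply: (eq_qchar_dvdp zetaP kM kS hM hS (psiP _ hM hS) _ eq_ch).
    exact: unitr1.
  case: eqP => [ed|nde]; last first.
    apply: big1 => a aU; apply/eqP; apply: contra_notT nde; exact: orth.
  (* For [e = d], distinct units give distinct characters, so only [a = 1] contributes. *)
  subst e; rewrite (bigD1 1) ?unitr1 //= sum_qchar_eq // big1 ?addr0 // => a.
  case/andP=> aU na; apply/eqP; apply: contraNT na => sum_n0.
  have eq_ch := sum_qchar_neq0 zetaP fM fS kM kS kf kM kS kf sum_n0.
  by rewrite (qchar_inj zetaP (psiP _ kM kS) eq_ch).
rewrite -big_mkcond /= big_const_seq iter_addr_0.
by rewrite -/(count_mem d _) count_uniq_mem ?fset_uniq.
Qed.

Theorem theorem2p3 (F : finFieldType) (p : nat) (pF : p \in [pchar F])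
    (C : numClosedFieldType) (zeta : C) (zetaP : p.-primitive_root zeta)
    (psi : forall h : {poly F}, {scalar {poly %/ h}})
    (psiP : forall h : {poly F}, h \is monic -> (1 < size h)%N ->
       nondegenerate_functional (psi h))
    (f : {poly F}) (f_monic : f \is monic) (f_nonconst : (1 < size f)%N)
    (D1 D2 : {fset {poly F}})
    (D1_Div : {subset D1 <= Div f}) (D2_Div : {subset D2 <= Div f})
    (D1_f : f \notin D1) (D2_f : f \notin D2)
    (eq_spec : spectral_vector pF zeta psi f D1 =
               spectral_vector pF zeta psi f D2) :
  D1 = D2.
Proof.
have sub D D' : {subset D <= Div f} -> {subset D' <= Div f} ->
    f \notin D -> f \notin D' ->
    spectral_vector pF zeta psi f D = spectral_vector pF zeta psi f D' ->
  {subset D <= D'}.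
  move=> DDiv D'Div Df D'f eqDD' d dD.
  have nd : d != f by apply: contraNneq Df => <-.
  have coefE := spectral_vector_coef pF zetaP psiP f_monic f_nonconst
    _ _ (DDiv _ dD) nd.
  have := coefE D DDiv Df; rewrite eqDD' (coefE D' D'Div D'f) dD => /eqP.
  (* Were [d] not in [D'], the cardinality of F[x]/f would be zero in [C], which has characteristic
     0. *)
  case: (d \in D') => //; rewrite eq_sym pnatr_eq0 => /eqP/card0_eq.
  by move=> /(_ 0); rewrite !inE.
by apply/fsetP => d; apply/idP/idP; apply: sub.
Qed.
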